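(* A supply graph $G$ has the strong uniqueness property if and only if $G$ contains no cycle of length $3$ or more (equivalently, $G$ is obtained from a forest by replacing some edges by sets of parallel edges).
   Context: A supply graph is a finite undirected graph $G=(V,E)$ without loops, parallel edges allowed (so cycles of length $2$ formed by two parallel edges may exist). Its directed version replaces each edge by two opposite arcs. A demand digraph is a simple digraph $H=(T,L)$ with $T\subseteq V$; its arcs are OD-pairs; routes for $(o,d)\in L$ are directed $(o,d)$-paths in the directed version of $G$. Users form a bounded interval with Lebesgue measure, measurably partitioned by OD-pair; each user picks a route of his OD-pair (measurably); flow on an arc is the measure of users using it; users have nonnegative continuous strictly increasing arc cost functions (measurable in the user); an equilibrium is a profile where every user takes a minimal-cost route. $(G,H)$ has the uniqueness property if for every measurable partition of users into OD-pairs and every such cost assignment, the flow on each arc is the same in all equilibria. $G$ has the strong uniqueness property if $(G,H)$ has the uniqueness property for every demand digraph $H=(T,L)$ with $T\subseteq V$. *)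

(* Defs.v *)
From HB Require Import structures.
From mathcomp Require Import all_boot all_order all_algebra.
From mathcomp Require Import all_classical all_reals all_analysis.
Set Implicit Arguments. Unset Strict Implicit. Unset Printing Implicit Defensive.
Import Order.TTheory GRing.Theory Num.Theory.
Import numFieldNormedType.Exports.
Local Open Scope classical_set_scope.
Local Open Scope ring_scope.

(** The real line equipped with the (complete) Lebesgue sigma-algebra, i.e.
    the measurable type on which [completed_lebesgue_measure] lives. *)
Definition LR (R : realType) :=
  ltac:(let t := type of (@completed_lebesgue_measure R) in
        match t with set ?T -> _ => exact T end).

Section SupplyGraph.
(** A supply graph: vertices [V], edges [E] (parallel edges allowed since
    distinct edges may have the same endpoints), [ends e] = endpoints of e. *)
Variables (V E : finType) (ends : E -> V * V).

Definition supply_graph : Prop := forall e : E, (ends e).1 != (ends e).2.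

Definition arc := (E * bool)%type.
Definition tail (a : arc) : V := if a.2 then (ends a.1).1 else (ends a.1).2.
Definition head (a : arc) : V := if a.2 then (ends a.1).2 else (ends a.1).1.

Definition is_route (o d : V) (p : seq arc) : bool :=
  [&& map tail p == belast o (map head p),
      last o (map head p) == d & uniq (o :: map head p)].

Definition has_cycle_len_ge3 : Prop :=
  exists (k : nat) (vs : 'I_k -> V) (es : 'I_k -> E),
    [/\ (3 <= k)%N, injective vs, injective es &
        forall i : 'I_k, ends (es i) = (vs i, vs (ordS i)) \/
                         ends (es i) = (vs (ordS i), vs i)].

Definition demand_digraph (T : {set V}) (L : {set V * V}) : Prop :=
  forall p, p \in L -> [/\ p.1 \in T, p.2 \in T & p.1 != p.2].

Variable R : realType.

(** Users: a bounded interval [I] of reals (with Lebesgue measure). *)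
Definition bounded_interval (I : set R) : Prop :=
  is_interval I /\ exists M : R, forall x, I x -> `|x| <= M.

Definition od_partition (I : set (LR R)) (L : {set V * V})
    (od : LR R -> V * V) : Prop :=
  (forall x, I x -> od x \in L) /\
  (forall p : V * V, measurable (I `&` od @^-1` [set p])).

Definition cost_assignment (I : set (LR R)) (c : arc -> LR R -> R -> R) : Prop :=
  (forall a x, I x ->
     [/\ forall u, 0 <= u -> 0 <= c a x u,
         {within [set u : R | 0 <= u], continuous (c a x)} &
         forall u v, 0 <= u -> u < v -> c a x u < c a x v]) /\
  (forall a (u : R), 0 <= u -> measurable_fun I (fun x => c a x u)).

Definition profile (I : set (LR R)) (od : LR R -> V * V)
    (route : LR R -> seq arc) : Prop :=
  (forall x, I x -> is_route (od x).1 (od x).2 (route x)) /\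
  (forall r : seq arc, measurable (I `&` route @^-1` [set r])).

Definition flow (I : set (LR R)) (route : LR R -> seq arc) (a : arc) : R :=
  fine (completed_lebesgue_measure (I `&` [set x | a \in route x])).

Definition route_cost (I : set (LR R)) (c : arc -> LR R -> R -> R)
    (route : LR R -> seq arc) (x : LR R) (r : seq arc) : R :=
  \sum_(a <- r) c a x (flow I route a).

Definition equilibrium (I : set (LR R)) (od : LR R -> V * V)
    (c : arc -> LR R -> R -> R) (route : LR R -> seq arc) : Prop :=
  profile I od route /\
  forall x, I x -> forall r, is_route (od x).1 (od x).2 r ->
    route_cost I c route x (route x) <= route_cost I c route x r.

Definition uniqueness_property (L : {set V * V}) : Prop :=
  forall (I : set R), bounded_interval I ->
  forall (od : LR R -> V * V) (c : arc -> LR R -> R -> R),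
    od_partition I L od -> cost_assignment I c ->
  forall route1 route2 : LR R -> seq arc,
    equilibrium I od c route1 -> equilibrium I od c route2 ->
  forall a : arc, flow I route1 a = flow I route2 a.

Definition strong_uniqueness_property : Prop :=
  forall (T : {set V}) (L : {set V * V}), demand_digraph T L ->
    uniqueness_property L.

End SupplyGraph.

(* Main.v *)
Require Import Defs.
From HB Require Import structures.
From mathcomp Require Import all_boot all_order all_algebra.
From mathcomp Require Import all_classical all_reals all_analysis.
From mathcomp Require Import lra zify.
(** Without a cycle of length at least 3, all routes of an OD-pair visit the same
    vertices and differ only in the choice among parallel arcs.  If some arc
    [u -> v] carries strictly more flow in the first equilibrium, the set of all
    arcs [u -> v] with this property is used by strictly more users in the first
    equilibrium, hence some user leaves it in the second; comparing the two
    parallel arcs that he uses contradicts strict monotonicity of his costs.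

    On a cycle [v0, ..., v(k-1)] with [k >= 3], three classes of users of
    measures 3, 2, 2 travel along [v0 -> v1], [v2 -> v1], [v0 -> v2].  Their
    affine costs are such that one equilibrium has the routes [v0 v1], [v2 v1],
    [v0 v(k-1) ... v2], and another one sends every class round the cycle in the
    opposite direction.  Optimality is certified by vertex potentials [P] with
    [P (head a) <= P (tail a) + cost a], tight along the used route; arcs off
    the cycle have a constant term at least as large as all potentials. *)

Set Implicit Arguments. Unset Strict Implicit. Unset Printing Implicit Defensive.
Import Order.TTheory GRing.Theory Num.Theory.
Import numFieldNormedType.Exports.
Local Open Scope classical_set_scope.
Local Open Scope ring_scope.

(** * Routes in a supply graph without cycles of length at least 3 *)

Section Acyclic.
Variables (V E : finType) (ends : E -> V * V).
Local Notation arc := (Defs.arc E).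
Local Notation tail := (Defs.tail ends).
Local Notation head := (Defs.head ends).

Definition adj (u v : V) : bool :=
  [exists a : arc, (tail a == u) && (head a == v)].

Definition flip (a : arc) : arc := (a.1, ~~ a.2).

Lemma tail_flip a : tail (flip a) = head a.
Proof. by case: a => e []. Qed.

Lemma head_flip a : head (flip a) = tail a.
Proof. by case: a => e []. Qed.

Lemma adjP u v : reflect (exists2 a, tail a = u & head a = v) (adj u v).
Proof.
apply: (iffP existsP) => [[a /andP[/eqP ta /eqP ha]]|[a ta ha]]; exists a => //.
by rewrite ta ha !eqxx.
Qed.

Lemma adjC : symmetric adj.
Proof.
suff adj_sym u v : adj u v -> adj v u by move=> u v; apply/idP/idP; exact: adj_sym.
by move=> /adjP[a ta ha]; apply/adjP; exists (flip a); rewrite ?tail_flip ?head_flip.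
Qed.

Lemma adj_ends u v : adj u v ->
  exists e, ends e = (u, v) \/ ends e = (v, u).
Proof.
case/adjP=> -[e b]; rewrite /Defs.tail /Defs.head /= => <- <-.
by exists e; case: b; case: (ends e) => x y; [left|right].
Qed.

(** The point where length at least 3 matters: on a closed walk of length 2, both steps could use
    the same edge. *)
Lemma ordS2_neq (k : nat) (i : 'I_k) : (3 <= k)%N -> ordS (ordS i) != i.
Proof.
move=> k3; apply/eqP => /(congr1 val) /=.
rewrite -addn1 modnDml addn1 => h.
have := ltn_ord i; case: (ltnP i.+2 k) => ki ik; first by move: h; rewrite modn_small //; lia.
by move: h; rewrite -(subnK ki) modnDr modn_small; lia.
Qed.

(** One edge is chosen for each pair of consecutive vertices. An edge chosen at two distinct indices
    would have to join the same two vertices in swapped order, hence [ordS (ordS i) = i], impossible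
    from three vertices on. *)
Lemma cycle_of_adj (u : V) (p : seq V) : uniq (u :: p) -> path adj u p ->
  adj u (last u p) -> (1 < size p)%N -> has_cycle_len_ge3 ends.
Proof.
move=> up pp lp sp; pose k := (size p).+1.
pose vs (i : 'I_k) := nth u (u :: p) i.
have vs_inj : injective vs.
  move=> i j /eqP; rewrite nth_uniq //; [by move/eqP/val_inj | exact: ltn_ord..].
have adj_vs i : adj (vs i) (vs (ordS i)).
  rewrite /vs /=; have := ltn_ord i; rewrite {2}/k ltnS leq_eqVlt => /orP[/eqP ei|ip].
    by rewrite ei modnn adjC /= -[size p]/(size p) -(last_nth u).
  by rewrite modn_small //; move/(pathP u): pp => /(_ _ ip).
have [es esE] := choice (fun i => adj_ends (adj_vs i)).
exists k, vs, es; split => // i j eij; apply: (vs_inj).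
have := esE j; rewrite -eij.
have no_swap : vs i = vs (ordS j) -> vs (ordS i) = vs j -> False.
  by move=> /vs_inj -> /vs_inj /eqP; apply/negP/ordS2_neq.
by case: (esE i) => ->; case=> -[] // *; case: no_swap.
Qed.

(** Induction along the common prefix. Where the paths first diverge, from [o] to [x] and to [y], a
    simple path from [x] to [y] avoiding [o] is extracted from their remainders and closes up
    through [o]. *)
Lemma acyclic_path_unique (o : V) (p q : seq V) : ~ has_cycle_len_ge3 ends ->
  uniq (o :: p) -> path adj o p -> uniq (o :: q) -> path adj o q ->
  last o p = last o q -> p = q.
Proof.
move=> acyc; elim: p o q => [|x p IH] o [|y q] //.
- by move=> _ _ /= /andP[+ _] _ eo; rewrite {1}eo mem_last.
- by move=> /= /andP[+ _] _ _ _ eo; rewrite -{1}eo mem_last.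
move=> /= /andP[onp uxp] /andP[ox pp] /andP[onq uyq] /andP[oy pq] lpq.
have [exy|nxy] := eqVneq x y.
  by subst y; congr cons; apply: IH pq lpq.
case: acyc.
(* The walk from [x] to the common endpoint and back to [y] avoids [o]. *)
pose w := p ++ rev (belast y q).
have lw : last x w = y.
  by rewrite last_cat lpq; case: (q) => //= z q'; rewrite rev_cons last_rcons.
have pw : path adj x w.
  by rewrite cat_path pp lpq rev_path; apply: sub_path pq => a b; rewrite adjC.
have onw : o \notin x :: w.
  rewrite -cat_cons mem_cat negb_or onp mem_rev.
  by apply: contra onq => /mem_belast.
have := lw; have := onw; case/shortenP: pw => s ps us ssub on_s ls.
have on_s' : o \notin x :: s.
  by apply: contra on_s; rewrite !inE => /orP[->//|/ssub ->]; rewrite orbT.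
apply: (@cycle_of_adj o (x :: s)); rewrite /= ?ox ?on_s' //.
  by rewrite ls.
(* As [x != y], the path [s] from [x] to [y] is not empty, so the cycle has at least three
   vertices. *)
by case: s ls {ps us ssub on_s on_s'} => //= exy; rewrite exy eqxx in nxy.
Qed.

Lemma path_adj_route o (r : seq arc) :
  map tail r = belast o (map head r) -> path adj o (map head r).
Proof.
elim: r o => //= a r IH o [ta tr]; rewrite IH // andbT.
by apply/adjP; exists a.
Qed.

Lemma acyclic_route_heads o d (r1 r2 : seq arc) : ~ has_cycle_len_ge3 ends ->
  is_route ends o d r1 -> is_route ends o d r2 -> map head r1 = map head r2.
Proof.
move=> acyc /and3P[/eqP t1 /eqP l1 u1] /and3P[/eqP t2 /eqP l2 u2].
by apply: (@acyclic_path_unique o); rewrite ?l1 //; exact: path_adj_route.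
Qed.

(** Both routes have the same sequences of heads and of tails, so arcs at equal positions are
    parallel. *)
Lemma acyclic_parallel_arc o d (r1 r2 : seq arc) a : ~ has_cycle_len_ge3 ends ->
  is_route ends o d r1 -> is_route ends o d r2 -> a \in r1 ->
  exists b, [/\ b \in r2, tail b = tail a & head b = head a].
Proof.
move=> acyc R1 R2 ar; have eh := acyclic_route_heads acyc R1 R2.
have et : map tail r1 = map tail r2.
  by case/and3P: R1 => /eqP -> _ _; case/and3P: R2 => /eqP -> _ _; rewrite eh.
have es : size r1 = size r2 by rewrite -(size_map head) eh size_map.
have ir : (index a r1 < size r1)%N by rewrite index_mem.
exists (nth a r2 (index a r1)); split; first by rewrite mem_nth -?es.
  by rewrite -(nth_map _ (tail a)) -?es // -et (nth_map a) // nth_index.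
by rewrite -(nth_map _ (head a)) -?es // -eh (nth_map a) // nth_index.
Qed.

Lemma route_head_inj o d (r : seq arc) a b :
  is_route ends o d r -> a \in r -> b \in r -> head a = head b -> a = b.
Proof.
case/and3P=> _ _ /andP[_ u] ar br e.
have : index (head a) (map head r) = index (head b) (map head r) by rewrite e.
move: u ar br e; elim: r => //= c r IH /andP[cn u].
rewrite !inE => /predU1P[->|ar] /predU1P[->|br] // e.
- by case/negP: cn; rewrite e map_f.
- by case/negP: cn; rewrite -e map_f.
by move=> _; apply: IH => //; rewrite e.
Qed.

Lemma route_replace o d (r : seq arc) a b :
  is_route ends o d r -> tail b = tail a -> head b = head a ->
  is_route ends o d [seq if c == a then b else c | c <- r].
Proof.
move=> R tb hb; rewrite /is_route -!map_comp.
have eh : map (head \o (fun c => if c == a then b else c)) r = map head r.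
  by apply: eq_map => c /=; case: eqP => // ->.
have et : map (tail \o (fun c => if c == a then b else c)) r = map tail r.
  by apply: eq_map => c /=; case: eqP => // ->.
by rewrite eh et.
Qed.

Lemma route_uniq o d (r : seq arc) : is_route ends o d r -> uniq r.
Proof. by case/and3P=> _ _ /andP[_ /map_uniq]. Qed.

End Acyclic.

(** * Flows as measures of sets of users, and uniqueness without long cycles *)

Section Flow.
Variables (R : realType) (V E : finType) (ends : E -> V * V).
Local Notation arc := (Defs.arc E).
Local Notation tail := (Defs.tail ends).
Local Notation head := (Defs.head ends).
Local Notation mu := (@completed_lebesgue_measure R).

Lemma measurable_completed (A : set R) :
  measurable A -> measurable (A : set (LR R)).
Proof. exact: sub_caratheodory. Qed.

(** There are countably many sequences of arcs, so the set is a countable union of fibres of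
    [route]. *)
Lemma measurable_users (I : set (LR R)) (route : LR R -> seq arc)
    (P : pred (seq arc)) :
  (forall r, measurable (I `&` route @^-1` [set r])) ->
  measurable (I `&` [set x | P (route x)]).
Proof.
move=> mr.
have -> : I `&` [set x | P (route x)] =
    \bigcup_(r : seq arc) (if P r then I `&` route @^-1` [set r] else set0).
  apply/seteqP; split => [x [Ix /= Px]|x [r _ ]]; first by exists (route x); rewrite ?Px.
  by case: ifP => [Pr [Ix /= rx]|_ []]; split; rewrite /= ?rx.
apply: countable_bigcupT_measurable => [|r]; first exact: countableP.
by case: ifP.
Qed.

(** Finiteness ensures that [fine] in the definition of [flow] loses no information. *)
Lemma bounded_lebesgue_lty (I A : set (LR R)) : bounded_interval I ->
  measurable A -> A `<=` I -> (mu A < +oo)%E.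
Proof.
case=> _ [M MI] mA AI.
apply: (@le_lt_trans _ _ (mu [set` `[- M, M]])); last first.
  have -> : mu [set` `[- M, M]] = lebesgue_measure [set` `[- M, M]] by [].
  by rewrite lebesgue_measure_itv /=; case: ifP => _; rewrite ?ltry.
have mM : measurable ([set` `[- M, M]] : set (LR R)).
  by apply: measurable_completed; exact: measurable_itv.
apply: le_measure; rewrite ?inE //.
by move=> x /AI /MI; rewrite /= in_itv /= ler_norml.
Qed.

(** Each user takes at most one arc of [s], so the sets of users of the single arcs are disjoint and
    their measures add up. *)
Lemma measure_cross (I : set (LR R)) (route : LR R -> seq arc) (s : seq arc) :
  bounded_interval I ->
  (forall r, measurable (I `&` route @^-1` [set r])) ->
  uniq s ->
  (forall x a b, I x -> a \in s -> b \in s -> a \in route x -> b \in route x -> a = b) ->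
  mu (I `&` [set x | has (mem s) (route x)]) = (\sum_(a <- s) flow I route a)%:E.
Proof.
move=> bI mr; elim: s => [_ _|a s IH /= /andP[nas us] inj].
  rewrite big_nil; have -> : I `&` [set x | has (mem [::]) (route x)] = set0.
    by apply/seteqP; split => x //= [_]; rewrite (eq_has (a2 := pred0)) ?has_pred0.
  exact: measure0.
have inj' x b c : I x -> b \in s -> c \in s -> b \in route x -> c \in route x -> b = c.
  by move=> Ix bs cs; apply: inj => //; rewrite inE ?bs ?cs orbT.
rewrite big_cons EFinD -(IH us inj') /flow.
have ma := measurable_users (fun r => a \in r) mr.
rewrite fineK ?ge0_fin_numE ?(bounded_lebesgue_lty bI ma) //.
rewrite -measureU //; last 2 first.
- by apply: (measurable_users (fun r => has (mem s) r)).
- apply/seteqP; split => // x [[Ix /= ax] [_ /hasP[b bx bs]]].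
  have {}bs : b \in s by [].
  have bas : b \in a :: s by rewrite inE bs orbT.
  by move: nas; rewrite (inj x a b Ix (mem_head a s) bas ax bx) bs.
congr (mu _); rewrite -setIUr; congr (_ `&` _); apply/seteqP; split => x /=.
  by case/hasP=> b bx /predU1P[<-|bs]; [left|right; apply/hasP; exists b].
case=> [ax|/hasP[b bx bs]]; apply/hasP; first by exists a => //; exact: mem_head.
by exists b => //; apply/predU1P; right.
Qed.

Lemma flow_ge0 I (route : LR R -> seq arc) a : 0 <= flow I route a.
Proof. exact/fine_ge0/measure_ge0. Qed.

(** Replacing [a] by [b] in the route of [x] gives another route of the same OD-pair; the costs of
    all other arcs cancel. *)
Lemma equilibrium_parallel (I : set (LR R)) od c route x a b :
  equilibrium ends I od c route -> I x -> a \in route x ->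
  tail b = tail a -> head b = head a ->
  c a x (flow I route a) <= c b x (flow I route b).
Proof.
case=> -[rt _] opt Ix ax tb hb.
have := opt x Ix _ (route_replace (rt x Ix) tb hb).
rewrite /route_cost big_map (bigD1_seq a) ?(route_uniq (rt x Ix)) //=.
rewrite [leRHS](bigD1_seq a) ?(route_uniq (rt x Ix)) //= eqxx.
rewrite [X in _ <= _ + X](eq_bigr (fun i => c i x (flow I route i))).
  by rewrite lerD2r.
by move=> i /negbTE ->.
Qed.

Lemma acyclic_uniqueness (L : {set V * V}) :
  ~ has_cycle_len_ge3 ends -> uniqueness_property ends R L.
Proof.
move=> acyc I bI od c _ [cI _] r1 r2 eq1 eq2.
wlog suff lef : r1 r2 eq1 eq2 / forall a, flow I r1 a <= flow I r2 a.
  by move=> a; apply/eqP; rewrite eq_le !lef.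
move=> a0; rewrite leNgt; apply/negP => gt0.
pose cl a := (tail a == tail a0) && (head a == head a0).
pose s := [seq a <- enum {: arc} | cl a && (flow I r2 a < flow I r1 a)].
have sP a : (a \in s) = cl a && (flow I r2 a < flow I r1 a).
  by rewrite mem_filter mem_enum andbT.
have us : uniq s by rewrite filter_uniq // enum_uniq.
have [[rt1 mr1] _] := eq1; have [[rt2 mr2] _] := eq2.
have inj r : profile ends I od r -> forall x a b, I x -> a \in s -> b \in s ->
    a \in r x -> b \in r x -> a = b.
  move=> [rt _] x a b Ix; rewrite !sP => /andP[/andP[_ /eqP ha] _] /andP[/andP[_ /eqP hb] _].
  by move=> ax bx; apply: (route_head_inj (rt x Ix)); rewrite // ha hb.
have m1 := measure_cross bI mr1 us (inj _ (proj1 eq1)).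
have m2 := measure_cross bI mr2 us (inj _ (proj1 eq2)).
have sum_lt : \sum_(a <- s) flow I r2 a < \sum_(a <- s) flow I r1 a.
  have a0s : a0 \in s by rewrite sP /cl !eqxx.
  rewrite !(bigD1_seq a0) //=; apply: ltr_leD => //.
  rewrite big_seq_cond [leRHS]big_seq_cond; apply: ler_sum => a.
  by rewrite sP => /andP[/andP[_ /ltW]].
have [x Ix /andP[x1 x2]] : exists2 x, I x & has (mem s) (r1 x) && ~~ has (mem s) (r2 x).
  (* Otherwise every user crossing [s] under [r1] also crosses it under [r2], and monotonicity of
     the measure contradicts [sum_lt]. *)
  apply: contrapT => nx; move: sum_lt; apply/negP; rewrite -leNgt -lee_fin -m1 -m2.
  apply: le_measure; rewrite ?inE.
  - exact: (measurable_users (fun r => has (mem s) r) mr1).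
  - exact: (measurable_users (fun r => has (mem s) r) mr2).
  - move=> x [Ix /= h1]; split=> //=; apply/negPn/negP => h2.
    by apply: nx; exists x; rewrite ?h1.
case/hasP: x1 => a ax /= as_.
have [b [bx tb hb]] := acyclic_parallel_arc acyc (rt1 x Ix) (rt2 x Ix) ax.
have bs : b \notin s by apply: contra x2 => bs; apply/hasP; exists b.
move: as_ bs; rewrite !sP /cl tb hb => /andP[-> fa] /=; rewrite -leNgt => fb.
have ca := cI a x Ix; have cb := cI b x Ix.
(* With [f1], [f2] the two flows, the cyclic chain is [c a (f2 a) < c a (f1 a) <= c b (f1 b) <= c b
   (f2 b) <= c a (f2 a)]. *)
have le1 := equilibrium_parallel eq1 Ix ax tb hb.
have le2 := equilibrium_parallel eq2 Ix bx (esym tb) (esym hb).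
have lt3 : c a x (flow I r2 a) < c a x (flow I r1 a).
  by case: ca => _ _; apply; rewrite ?flow_ge0.
have le4 : c b x (flow I r1 b) <= c b x (flow I r2 b).
  case: cb => _ _ mono; move: fb; rewrite le_eqVlt => /orP[/eqP -> //|fb].
  by rewrite ltW // mono ?flow_ge0.
by have := lt_le_trans lt3 (le_trans le1 (le_trans le4 le2)); rewrite ltxx.
Qed.

End Flow.

(** * Three classes of users: reducing non-uniqueness to data on natural numbers *)

Section ThreeClasses.
Variables (R : realType) (V E : finType) (ends : E -> V * V).
Local Notation arc := (Defs.arc E).
Local Notation tail := (Defs.tail ends).
Local Notation head := (Defs.head ends).
Local Notation mu := (@completed_lebesgue_measure R).

(** The inequalities for the arcs telescope along the route; this is weak duality for shortest
    paths. *)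
Lemma route_cost_potential (w : arc -> R) (P : V -> R) o d (r : seq arc) :
  (forall a, P (head a) <= P (tail a) + w a) -> is_route ends o d r ->
  P d - P o <= \sum_(a <- r) w a.
Proof.
move=> Pw /and3P[/eqP t /eqP l _]; elim: r o t l => [|a r IH] o /=.
  by move=> _ ->; rewrite big_nil subrr.
move=> [ta tr] l; rewrite big_cons; have := IH _ tr l; have := Pw a; rewrite ta; lra.
Qed.

Lemma route_cost_tight (w : arc -> R) (P : V -> R) o d (r : seq arc) :
  {in r, forall a, P (head a) = P (tail a) + w a} -> is_route ends o d r ->
  \sum_(a <- r) w a = P d - P o.
Proof.
move=> + /and3P[/eqP t /eqP l _]; elim: r o t l => [|a r IH] o /=.
  by move=> _ -> _; rewrite big_nil subrr.
move=> [ta tr] l Pw; rewrite big_cons (IH _ tr l) => [|b br].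
  by have := Pw a (mem_head _ _); rewrite ta; lra.
by apply: Pw; rewrite inE br orbT.
Qed.

(** The length 7 is the total 3 + 2 + 2 of the measures of the three classes. *)
Definition users : set (LR R) := [set` `[0 : R, 7]].

Definition user_class (x : LR R) : nat :=
  if (x : R) < 3 then 0 else if (x : R) < 5 then 1 else 2.

Lemma users_bounded : bounded_interval users.
Proof.
split; first exact: interval_is_interval.
by exists 7 => x; rewrite /users /= in_itv /= => /andP[? ?]; rewrite ler_norml; lra.
Qed.

Lemma users_class_itv (j : nat) :
  users `&` [set x | user_class x = j] =
  match j with
  | 0 => [set` `[0 : R, 3[] | 1 => [set` `[3 : R, 5[] | 2 => [set` `[5 : R, 7]]
  | _ => set0
  end.
Proof.
apply/seteqP; split => x; rewrite /users /user_class.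
  move=> [/=]; rewrite in_itv /= => /andP[x0 x7].
  case: ltP => x3; first by move=> <- /=; rewrite in_itv /= x0.
  case: ltP => x5; first by move=> <- /=; rewrite in_itv /= x3.
  by move=> <- /=; rewrite in_itv /= x5.
case: j => [|[|[|//]]] /=; rewrite !in_itv /= => /andP[a b].
- by split; [lra|rewrite b].
- by split; [lra|rewrite b ltNge a].
- by split; [lra|]; rewrite !ltNge a (le_trans _ a) //; lra.
Qed.

(** OD-pairs, costs and routes of the counterexample depend on a user only through the class, so all
    measurability conditions reduce to this one. *)
Lemma measurable_class (Q : pred nat) :
  measurable (users `&` [set x | Q (user_class x)]).
Proof.
have -> : users `&` [set x | Q (user_class x)] =
    \bigcup_(j : nat) (if Q j then users `&` [set x | user_class x = j] else set0).
  apply/seteqP; split => [x [Ix /= Px]|x [j _ ]]; first by exists (user_class x); rewrite ?Px.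
  by case: ifP => [Qj [Ix /= xj]|_ []]; split; rewrite /= ?xj.
apply: bigcupT_measurable => j; case: ifP => // _; rewrite users_class_itv.
by case: j => [|[|[|j]]] //; apply: measurable_completed; exact: measurable_itv.
Qed.

Lemma users_class_measure (j : nat) :
  mu (users `&` [set x | user_class x = j]) =
  (match j with 0 => 3 | 1 | 2 => 2 | _ => 0 end)%:R%:E.
Proof.
rewrite users_class_itv.
have mui (i : interval R) : mu [set` i] = lebesgue_measure [set` i] by [].
case: j => [|[|[|j]]]; last exact: measure0.
all: rewrite mui lebesgue_measure_itv /= lte_fin ifT; last by lra.
all: by rewrite -EFinB; congr (_%:E); lra.
Qed.

Lemma class_measure (Q : pred nat) :
  mu (users `&` [set x | Q (user_class x)]) = (3 * Q 0 + 2 * Q 1 + 2 * Q 2)%N%:R%:E.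
Proof.
pose A j : set (LR R) := users `&` [set x | (Q j && (user_class x == j))].
have mA j : measurable (A j) by exact: (measurable_class (fun i => Q j && (i == j))).
have muA j : mu (A j) = (Q j * match j with 0 => 3 | 1 | 2 => 2 | _ => 0 end)%N%:R%:E.
  rewrite /A; case: (Q j).
    rewrite mul1n -users_class_measure; congr (mu (_ `&` _)).
    by apply/seteqP; split => x /= /eqP.
  by rewrite mul0n (_ : [set _ | _] = set0) ?setI0 ?measure0 // -subset0 => x.
have -> : users `&` [set x | Q (user_class x)] = A 0 `|` A 1 `|` A 2.
  rewrite /A -!setIUr; congr (_ `&` _); apply/seteqP; split => x /=; last first.
    by case=> [[]|] /andP[+ /eqP ->].
  rewrite /user_class; case: ltP => _; first by move=> ->; do 2 left.
  by case: ltP => _ ->; [left; right|right].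
rewrite measureU ?measureU //.
- transitivity (mu (A 0%N) + mu (A 1%N) + mu (A 2%N))%E => //.
  by rewrite !muA -!EFinD -!natrD; congr (_%:R%:E); lia.
- by apply/seteqP; split => // x [[_ /andP[_ /eqP e]] [_ /andP[_]]]; rewrite e.
- exact: measurableU.
- by apply/seteqP; split => // x [[] [_ /andP[_ /eqP e]] [_ /andP[_]]]; rewrite e.
Qed.

Definition class_flow (r : nat -> seq arc) (a : arc) : nat :=
  3 * (a \in r 0) + 2 * (a \in r 1) + 2 * (a \in r 2).

Lemma flow_class (r : nat -> seq arc) a :
  flow users (r \o user_class) a = (class_flow r a)%:R.
Proof. by rewrite /flow (class_measure (fun j => a \in r j)). Qed.

(** A dual certificate that [r] is a cheapest route for the weights [w]. Natural numbers keep its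
    verification within linear integer arithmetic. *)
Definition tight_potential (w : arc -> nat) (r : seq arc) (P : V -> nat) :=
  (forall a, P (head a) <= P (tail a) + w a)%N /\
  {in r, forall a, P (head a) = P (tail a) + w a}%N.

Lemma class_equilibrium (o d : nat -> V) (alpha beta : nat -> arc -> nat)
    (r : nat -> seq arc) (P : nat -> V -> nat) :
  (forall j, is_route ends (o j) (d j) (r j)) ->
  (forall j, tight_potential (fun a => alpha j a + beta j a * class_flow r a)%N
     (r j) (P j)) ->
  equilibrium ends users (fun x => (o (user_class x), d (user_class x)))
    (fun a x u => (alpha (user_class x) a)%:R + (beta (user_class x) a)%:R * u)
    (r \o user_class).
Proof.
move=> Rr TP; split.
  split=> [x _|s]; first exact: Rr.
  rewrite (_ : _ @^-1` _ = [set x | r (user_class x) == s]).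
    exact: (measurable_class (fun j => r j == s)).
  by apply/seteqP; split => x /= /eqP.
move=> x _ s Rs; rewrite /route_cost /=; set j := user_class x.
have [Ple Peq] := TP j.
pose w a : R := (alpha j a + beta j a * class_flow r a)%N%:R.
have sw q : \sum_(a <- q) ((alpha j a)%:R + (beta j a)%:R * flow users (r \o user_class) a)
    = \sum_(a <- q) w a.
  by apply: eq_bigr => a _; rewrite flow_class /w natrD natrM.
rewrite !sw (@route_cost_tight _ (fun v => (P j v)%:R) (o j) (d j)) //.
  apply: (@route_cost_potential _ (fun v => (P j v)%:R)) => // a.
  by rewrite /w -natrD ler_nat.
by move=> a ar; rewrite /w -natrD Peq.
Qed.

(** Both certified profiles are equilibria for the same affine costs, whose positive slopes [beta]
    make them strictly increasing. *)
Lemma three_classes_not_unique (o d : nat -> V) (alpha beta : nat -> arc -> nat)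
    (r1 r2 : nat -> seq arc) (P1 P2 : nat -> V -> nat) (a0 : arc) :
  (forall j, o j != d j) -> (forall j a, 0 < beta j a)%N ->
  (forall j, is_route ends (o j) (d j) (r1 j)) ->
  (forall j, is_route ends (o j) (d j) (r2 j)) ->
  (forall j, tight_potential (fun a => alpha j a + beta j a * class_flow r1 a)%N
     (r1 j) (P1 j)) ->
  (forall j, tight_potential (fun a => alpha j a + beta j a * class_flow r2 a)%N
     (r2 j) (P2 j)) ->
  class_flow r1 a0 != class_flow r2 a0 ->
  ~ strong_uniqueness_property ends R.
Proof.
move=> od b0 R1 R2 T1 T2 /eqP na uni.
pose L : {set V * V} := [set p | [|| p == (o 0, d 0), p == (o 1, d 1) | p == (o 2, d 2)]]%SET.
have dL : demand_digraph [set: V]%SET L.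
  by move=> p; rewrite !inE => /or3P[] /eqP ->; split=> //=; exact: od.
have e1 := class_equilibrium R1 T1; have e2 := class_equilibrium R2 T2.
apply: na; apply/eqP; rewrite -(eqr_nat R) -!flow_class; apply/eqP.
apply: (uni _ _ dL _ users_bounded _ _ _ _ _ _ e1 e2).
  split=> [x _|p].
    by rewrite inE /user_class; case: ifP => _; [|case: ifP => _]; rewrite eqxx ?orbT.
  rewrite (_ : _ @^-1` _ = [set x | (o (user_class x), d (user_class x)) == p]).
    exact: (measurable_class (fun j => (o j, d j) == p)).
  by apply/seteqP; split => x /= /eqP.
split=> [a x _|a u u0].
  split=> [u u0||u v u0 uv].
  - by rewrite addr_ge0 // mulr_ge0.
  - apply: continuous_subspaceT => u; apply: cvgD; first exact: cvg_cst.
    by apply: cvgM; [exact: cvg_cst|exact: cvg_id].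
  - by rewrite ltrD2l ltr_pM2l // ltr0n.
move=> _ Y mY.
have := measurable_class (fun j => `[< Y ((alpha j a)%:R + (beta j a)%:R * u) >]).
congr (measurable (_ `&` _)); apply/seteqP; split => x /=; first by move/asboolP.
by move=> ?; apply/asboolP.
Qed.

End ThreeClasses.

(** * Vertices, directed edges and routes on a cycle *)

Lemma iota_consE (i m : nat) : i :: iota i.+1 m = rcons (iota i m) (i + m)%N.
Proof. by rewrite -/(iota i m.+1) -addn1 iotaD cats1. Qed.

Lemma modnSml (i d : nat) : ((i %% d).+1 %% d = i.+1 %% d)%N.
Proof. by rewrite -addn1 modnDml addn1. Qed.

Section Cycle.
Local Open Scope nat_scope.
Variables (V E : finType) (ends : E -> V * V) (n : nat).
Local Notation k := n.+3.
Variables (vs : 'I_k -> V) (es : 'I_k -> E).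
Hypotheses (vs_inj : injective vs) (es_inj : injective es).
Hypothesis ends_es : forall i : 'I_k, ends (es i) = (vs i, vs (ordS i)) \/
                                      ends (es i) = (vs (ordS i), vs i).
Local Notation arc := (Defs.arc E).
Local Notation tail := (Defs.tail ends).
Local Notation head := (Defs.head ends).

(** Indices are read modulo [k], so a route may run past the last vertex without case
    distinction. *)
Definition cvert (i : nat) : V := vs (inZp i).

(* [dart true i] runs from the [i]th to the [i.+1]th vertex, [dart false i] back. *)
Definition dart (b : bool) (i : nat) : arc :=
  (es (inZp i), (ends (es (inZp i)) == (cvert i, cvert i.+1)) == b).

Lemma cvert_mod i j : cvert i = cvert j -> i = j %[mod k].
Proof. by move/vs_inj/(congr1 val). Qed.

Lemma cvertDk i : cvert (i + k) = cvert i.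
Proof. by congr vs; apply: val_inj; rewrite /= modnDr. Qed.

Lemma cvert_k : cvert k = cvert 0.
Proof. exact: (cvertDk 0). Qed.

Lemma cvertS i : vs (ordS (inZp i)) = cvert i.+1.
Proof. by congr vs; apply: val_inj; rewrite /= modnSml. Qed.

Lemma cvert_neqS i : cvert i != cvert i.+1.
Proof.
apply/eqP => /cvert_mod /eqP.
by rewrite eq_sym eqn_mod_dvd // subSnn dvdn1.
Qed.

Lemma dart_ends b i : tail (dart b i) = cvert (if b then i else i.+1) /\
  head (dart b i) = cvert (if b then i.+1 else i).
Proof.
rewrite /Defs.tail /Defs.head /dart /=.
have := ends_es (inZp i); rewrite cvertS -/(cvert i) => -[] ->.
  by rewrite eqxx; case: b.
by rewrite xpair_eqE (negbTE (cvert_neqS i)) andbF; case: b.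
Qed.

Lemma dart_k b : dart b k = dart b 0.
Proof.
rewrite /dart (_ : inZp k = inZp 0); last by apply: val_inj; rewrite /= modnn mod0n.
by rewrite cvert_k -cvertS (_ : inZp k = inZp 0) ?cvertS //; apply: val_inj; rewrite /= modnn mod0n.
Qed.

Lemma inZp_inj (i j : nat) : (i < k) -> (j < k) ->
  inZp i = inZp j :> 'I_k -> i = j.
Proof. by move=> ik jk /(congr1 val) /=; rewrite !modn_small. Qed.

Lemma dart_inj b c i j : (i < k) -> (j < k) ->
  dart b i = dart c j -> b = c /\ i = j.
Proof.
move=> ik jk [/es_inj /(inZp_inj ik jk) -> p]; split=> //.
by move: p; case: (ends _ == _); case: b; case: c.
Qed.

Lemma mem_darts b c i (l : seq nat) : (i < k) -> all (fun j => j < k) l ->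
  (dart b i \in map (dart c) l) = (b == c) && (i \in l).
Proof.
move=> ik /allP lk; apply/mapP/andP => [[j jl /(dart_inj ik (lk _ jl))[-> ->]]|[/eqP -> il]] //.
by exists i.
Qed.

(** Two of these indices differ by less than [k], hence agree modulo [k] only when equal. *)
Lemma cvert_uniq i m : (m < k) -> uniq (map cvert (iota i m.+1)).
Proof.
move=> mk; rewrite map_inj_in_uniq ?iota_uniq // => a b.
rewrite !mem_iota => ha hb /cvert_mod.
wlog ab : a b ha hb / (a <= b).
  by move=> h e; case/orP: (leq_total a b) => ab; [|symmetry]; apply: h.
move/eqP; rewrite eq_sym eqn_mod_dvd //.
case: (posnP (b - a)) => [|p]; first lia.
by move/(dvdn_leq p); lia.
Qed.

Lemma route_forward i m : (m < k) ->
  is_route ends (cvert i) (cvert (i + m)) (map (dart true) (iota i m)).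
Proof.
move=> mk; rewrite /is_route -!map_comp.
rewrite (eq_map (f := tail \o dart true) (g := cvert)) => [|j]; last exact: (proj1 (dart_ends true j)).
rewrite (eq_map (f := head \o dart true) (g := cvert \o succn)) => [|j]; last exact: (proj2 (dart_ends true j)).
rewrite map_comp -[map succn _]/(map (addn 1) _) -iotaDl add1n.
rewrite -map_cons -/(iota i m.+1) cvert_uniq // belast_map last_map andbT.
(* Both sides list the visited indices [i, ..., i + m]; splitting off the last one identifies the
   tails and the final vertex together. *)
have /rcons_inj[-> ->] : rcons (belast i (iota i.+1 m)) (last i (iota i.+1 m)) =
    rcons (iota i m) (i + m) by rewrite -lastI iota_consE.
by rewrite !eqxx.
Qed.

Lemma route_backward i m : (m < k) ->
  is_route ends (cvert (i + m)) (cvert i) (map (dart false) (rev (iota i m))).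
Proof.
move=> mk; rewrite /is_route -!map_comp.
rewrite (eq_map (f := tail \o dart false) (g := cvert \o succn)) => [|j]; last exact: (proj1 (dart_ends false j)).
rewrite (eq_map (f := head \o dart false) (g := cvert)) => [|j]; last exact: (proj2 (dart_ends false j)).
rewrite map_comp map_rev -[map succn _]/(map (addn 1) _) -iotaDl add1n.
rewrite -map_cons belast_map last_map -rev_rcons -iota_consE [map cvert (rev (_ :: _))]map_rev rev_uniq.
rewrite -/(iota i m.+1) cvert_uniq // andbT.
have /rcons_inj[-> ->] : rcons (belast (i + m) (rev (iota i m))) (last (i + m) (rev (iota i m))) =
    rcons (rev (iota i.+1 m)) i by rewrite -lastI -rev_rcons -iota_consE rev_cons.
by rewrite !eqxx.
Qed.

(** * Coefficients and potentials prescribed by position on the cycle *)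

Definition dart_index (a : arc) : nat :=
  index a.1 [seq es (inZp i) | i <- iota 0 k].

(** For an arc whose edge is off the cycle, [dart_index] returns [k], which selects the default. *)
Definition arc_coef (f : bool -> nat -> nat) (dflt : nat) (a : arc) : nat :=
  let i := dart_index a in if (i < k) then f (a == dart true i) i else dflt.

Lemma dart_index_dart b i : (i < k) -> dart_index (dart b i) = i.
Proof.
move=> ik; rewrite /dart_index.
have -> : (dart b i).1 = nth (es ord0) [seq es (inZp i) | i <- iota 0 k] i.
  by rewrite (nth_map 0) ?size_iota // nth_iota.
rewrite index_uniq ?size_map ?size_iota // map_inj_in_uniq ?iota_uniq //.
by move=> a b'; rewrite !mem_iota => ha hb /es_inj /inZp_inj; apply.
Qed.

Lemma arc_coef_dart f dflt b i : (i < k) -> arc_coef f dflt (dart b i) = f b i.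
Proof.
move=> ik; rewrite /arc_coef dart_index_dart // ik; congr (f _ i).
by apply/eqP/idP => [/(dart_inj ik ik)[] //|->].
Qed.

Lemma dart_or_off a : (exists b i, (i < k) /\ a = dart b i) \/
  (forall f dflt, arc_coef f dflt a = dflt).
Proof.
have [ik|ki] := ltnP (dart_index a) k; last by right=> f dflt; rewrite /arc_coef ltnNge ki.
left.
have : a.1 \in [seq es (inZp i) | i <- iota 0 k].
  by rewrite -index_mem size_map size_iota.
case/mapP => i; rewrite mem_iota => /andP[_ i_k] ai.
exists (a.2 == (ends (es (inZp i)) == (cvert i, cvert i.+1))), i; split=> //.
by rewrite /dart -ai; case: a {ai ik} => e c /=; case: c; case: (ends _ == _).
Qed.

(** Vertices off the cycle have index [k] and thus receive the value [p k]. *)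
Definition vert_pot (p : nat -> nat) (x : V) : nat :=
  p (index x (map cvert (iota 0 k))).

Lemma vert_pot_cvert p i : p k = p 0 -> (i <= k) -> vert_pot p (cvert i) = p i.
Proof.
move=> pk; suff lt_k j : (j < k) -> vert_pot p (cvert j) = p j.
  by rewrite leq_eqVlt => /predU1P[->|/lt_k //]; rewrite cvert_k lt_k.
move=> jk; rewrite /vert_pot; congr p.
have -> : cvert j = nth (cvert 0) (map cvert (iota 0 k)) j.
  by rewrite (nth_map 0) ?size_iota // nth_iota.
by rewrite index_uniq ?size_map ?size_iota // cvert_uniq.
Qed.

(** Arcs off the cycle cost at least [M], which bounds every potential, so only arcs of the cycle
    need checking. The condition [p k = p 0] covers the step from the last vertex back to the
    first. *)
Lemma cycle_tight_potential (w : arc -> nat) (W : bool -> nat -> nat) (M : nat)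
    (p : nat -> nat) b l :
  (forall c i, (i < k) -> w (dart c i) = W c i) ->
  (forall a, (forall f dflt, arc_coef f dflt a = dflt) -> M <= w a) ->
  (forall i, p i <= M) -> p k = p 0 -> all (fun i => i < k) l ->
  (forall i, i < k -> p i.+1 <= p i + W true i) ->
  (forall i, i < k -> p i <= p i.+1 + W false i) ->
  (forall i, i \in l -> if b then p i.+1 = p i + W b i else p i = p i.+1 + W b i) ->
  tight_potential ends w (map (dart b) l) (vert_pot p).
Proof.
move=> wW wM pM pk /allP lk fw bw tight; split.
  move=> a; case: (dart_or_off a) => [[c [i [ik ->]]]|/wM Mw].
    have [-> ->] := dart_ends c i; rewrite wW //.
    by case: c; rewrite !vert_pot_cvert ?fw ?bw // ltnW.
  exact: leq_trans (leq_trans (pM _) Mw) (leq_addl _ _).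
move=> a /mapP[i il ->]; have ik := lk i il.
have [-> ->] := dart_ends b i; rewrite wW //.
by case: b {tight} (tight i il) => e; rewrite !vert_pot_cvert // ltnW.
Qed.

(** * The two profiles on the cycle, their costs and their potentials *)

Definition orig (j : nat) : V := cvert (if j == 1 then 2 else 0).
Definition dest (j : nat) : V := cvert (if (j < 2) then 1 else 2).

Definition dir1 (j : nat) : bool := j == 0.
(** Positions are listed in order of travel, hence reversed on backward routes. Every [j >= 2] is
    treated as class 2, so that the results hold for all [j : nat]. *)
Definition idx1 (j : nat) : seq nat :=
  match j with 0 => [:: 0] | 1 => [:: 1] | _ => rev (iota 2 n.+1) end.
Definition idx2 (j : nat) : seq nat :=
  match j with 0 => rev (iota 1 n.+2) | 1 => rcons (iota 2 n.+1) 0 | _ => [:: 0; 1] end.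
Definition profile1 j := map (dart (dir1 j)) (idx1 j).
Definition profile2 j := map (dart (~~ dir1 j)) (idx2 j).

Lemma idx1_lt j : all (fun i => i < k) (idx1 j).
Proof.
by case: j => [|[|j]] //; apply/allP => i; rewrite /idx1 mem_rev mem_iota; lia.
Qed.

Lemma idx2_lt j : all (fun i => i < k) (idx2 j).
Proof.
case: j => [|[|j]] //; apply/allP => i; rewrite /idx2.
  by rewrite mem_rev mem_iota; lia.
by rewrite mem_rcons inE mem_iota; lia.
Qed.

Lemma profile1_route j : is_route ends (orig j) (dest j) (profile1 j).
Proof.
case: j => [|[|j]].
- exact: (@route_forward 0 1).
- exact: (@route_backward 1 1).
- by rewrite /orig /dest /= -cvert_k; exact: (@route_backward 2 n.+1).
Qed.

Lemma profile2_route j : is_route ends (orig j) (dest j) (profile2 j).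
Proof.
case: j => [|[|j]].
- by rewrite /orig /dest /= -cvert_k; exact: (@route_backward 1 n.+2).
- have -> : profile2 1 = map (dart true) (iota 2 n.+2).
    (* The final position 0 in [idx2 1] is position [k] read modulo [k], so the route is one forward
       run. *)
    by rewrite /profile2 /idx2 map_rcons -dart_k -map_rcons -iota_consE.
  rewrite /orig /dest /=; have <- : cvert (2 + n.+2) = cvert 1 by rewrite -(cvertDk 1); congr cvert; lia.
  exact: route_forward.
- exact: (@route_forward 0 2).
Qed.

Definition flow1 (b : bool) (i : nat) : nat :=
  if b then (if i == 0 then 3 else 0) else (if i == 0 then 0 else 2).
Definition flow2 (b : bool) (i : nat) : nat :=
  if b then (if i == 0 then 4 else 2) else (if i == 0 then 0 else 3).

Ltac split_ifs := repeat (case: ifP => ?).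

Lemma profile1_flow b i : (i < k) -> class_flow profile1 (dart b i) = flow1 b i.
Proof.
move=> ik; rewrite /class_flow /profile1 !(mem_darts _ _ ik) ?idx1_lt //.
by rewrite /idx1 mem_rev mem_iota !inE /flow1 /dir1; case: b => /=; split_ifs; lia.
Qed.

Lemma profile2_flow b i : (i < k) -> class_flow profile2 (dart b i) = flow2 b i.
Proof.
move=> ik; rewrite /class_flow /profile2 !(mem_darts _ _ ik) ?idx2_lt //.
by rewrite /idx2 mem_rev mem_rcons !inE !mem_iota /flow2 /dir1; case: b => /=; split_ifs; lia.
Qed.

Local Notation lam := (5 * k).

(* For each class, the first arc of its first route has slope [lam], and the first
   arc of its second route has a constant term offsetting [lam] times the flow of
   the former in the first profile.  That flow is one larger in the second
   profile, and [lam] dominates all remaining costs. *)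
Definition coefA (j : nat) (b : bool) (i : nat) : nat :=
  match j with
  | 0 => if ~~ b && (i == n.+2) then 3 * lam else 0
  | 1 => if b && (i == 2) then 2 * lam else 0
  | _ => if b && (i == 0) then 2 * lam + 2 * k else 0
  end.
Definition coefB (j : nat) (b : bool) (i : nat) : nat :=
  match j with
  | 0 => if b && (i == 0) then lam else 1
  | 1 => if ~~ b && (i == 1) then lam else 1
  | _ => if ~~ b && (i == n.+2) then lam else 1
  end.
(** Along the route of class [j], the cost accumulated from [orig j]. The test [k <= i] makes the
    values at [k] and 0 agree. *)
Definition pot1 (j i : nat) : nat :=
  match j with
  | 0 => if (i == 0) || (k <= i) then 0 else 3 * lam
  | 1 => if i == 2 then 0 else 2 * lam
  | _ => if (i == 0) || (k <= i) then 0
         else if i <= 2 then 2 * lam + 2 * n else 2 * lam + 2 * (n.+2 - i)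
  end.
Definition pot2 (j i : nat) : nat :=
  match j with
  | 0 => if (i == 0) || (k <= i) then 0 else 3 * lam + 3 * (k - i)
  | 1 => if (i == 0) || (k <= i) then 2 * lam + 2 * n.+1
         else if i == 1 then 2 * lam + 2 * k
         else if i == 2 then 0 else 2 * lam + 2 * (i - 2)
  | _ => if (i == 0) || (k <= i) then 0
         else if i == 1 then 2 * lam + 2 * k + 4 else 2 * lam + 2 * k + 6
  end.

(** The default [5 * lam] exceeds every value of [pot1] and [pot2], which makes arcs off the cycle
    unattractive. *)
Definition alpha (j : nat) : arc -> nat := arc_coef (coefA j) (5 * lam).
Definition beta (j : nat) : arc -> nat := arc_coef (coefB j) 1.

Lemma beta_gt0 j a : (0 < beta j a).
Proof.
case: (dart_or_off a) => [[b [i [ik ->]]]|off]; last by rewrite /beta off.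
by rewrite /beta arc_coef_dart //; case: j => [|[|j]] /=; case: ifP.
Qed.

Lemma profile1_tight j : tight_potential ends
  (fun a => alpha j a + beta j a * class_flow profile1 a)
  (profile1 j) (vert_pot (pot1 j)).
Proof.
apply: (@cycle_tight_potential _
  (fun b i => coefA j b i + coefB j b i * flow1 b i) (5 * lam)) => //.
- by move=> b i ik; rewrite /alpha /beta !arc_coef_dart // profile1_flow.
- by move=> a off; rewrite /alpha off leq_addr.
- by move=> i; case: j => [|[|j]] /=; split_ifs; lia.
- by case: j => [|[|j]] /=; split_ifs; lia.
- exact: idx1_lt.
- by move=> i ik; case: j => [|[|j]] /=; split_ifs; lia.
- by move=> i ik; case: j => [|[|j]] /=; split_ifs; lia.
- move=> i; case: j => [|[|j]]; rewrite /idx1 ?mem_rev ?mem_iota ?inE /= => hi; split_ifs; lia.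
Qed.

Lemma profile2_tight j : tight_potential ends
  (fun a => alpha j a + beta j a * class_flow profile2 a)
  (profile2 j) (vert_pot (pot2 j)).
Proof.
apply: (@cycle_tight_potential _
  (fun b i => coefA j b i + coefB j b i * flow2 b i) (5 * lam)) => //.
- by move=> b i ik; rewrite /alpha /beta !arc_coef_dart // profile2_flow.
- by move=> a off; rewrite /alpha off leq_addr.
- by move=> i; case: j => [|[|j]] /=; split_ifs; lia.
- by case: j => [|[|j]] /=; split_ifs; lia.
- exact: idx2_lt.
- by move=> i ik; case: j => [|[|j]] /=; split_ifs; lia.
- by move=> i ik; case: j => [|[|j]] /=; split_ifs; lia.
- move=> i; case: j => [|[|j]]; rewrite /idx2 ?mem_rev ?mem_rcons ?inE ?mem_iota /= => hi; split_ifs; lia.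
Qed.

Lemma cycle_not_unique (R : realType) : ~ strong_uniqueness_property ends R.
Proof.
(* The arc [dart true 0] carries 3 in the first profile, from class 0, and 2 + 2 in the second, from
   classes 1 and 2. *)
apply: (three_classes_not_unique (a0 := dart true 0) _ beta_gt0 profile1_route
  profile2_route profile1_tight profile2_tight).
  move=> j; rewrite /orig /dest; apply/eqP => /cvert_mod.
  by case: j => [|[|j]] /=; rewrite !modn_small.
by rewrite profile1_flow // profile2_flow.
Qed.

End Cycle.

Theorem theorem3 (R : realType) (V E : finType) (ends : E -> V * V) :
  supply_graph ends ->
  (strong_uniqueness_property ends R <-> ~ has_cycle_len_ge3 ends).
Proof.
move=> _; split=> [uni [k [vs [es [k3 vs_inj es_inj ends_es]]]]|acyc T L _].
  case: k k3 vs es vs_inj es_inj ends_es => [|[|[|n]]] // _ vs es vs_inj es_inj ends_es.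
  exact: (cycle_not_unique vs_inj es_inj ends_es uni).
exact: acyclic_uniqueness.
Qed.
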